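(* Let $f\colon\mathbb{R}^n\to\mathbb{R}$ be continuously differentiable, let $x,p\in\mathbb{R}^n$ with $p^\top\nabla f(x)<0$, and let $\phi(\alpha)=f(x+\alpha p)$. Let $\mu\in(0,1)$, let $c\in\mathbb{R}$ with $c>1$, and let $\alpha_{\max}\in(0,\infty]$. Let $\psi(\alpha)=\phi(\alpha)-(\phi(0)+\mu\,\phi'(0)\,\alpha)$. Let $\phi_{\min}\in\mathbb{R}$ be a strict lower bound for $\phi$, i.e. $\phi(\alpha)>\phi_{\min}$ for all $\alpha\ge 0$. Let $[\alpha_l,\alpha_u]$ with $\alpha_l=0$ and $\alpha_u=\alpha_0=\min(1,\alpha_{\max})$ be the initial interval. Then the number of interval updates of the form $$[\alpha_l,\alpha_u]\leftarrow[\alpha_u,\min(c\cdot\alpha_u,\alpha_{\max})]$$ until $\alpha_u=\alpha_{\max}$ or $\psi(\alpha_u)\ge\psi(\alpha_l)$ or $\psi'(\alpha_u)\ge 0$ is bounded from above by $$\left\lceil\frac{1}{\alpha_0}\log_c\left(\min\left(\frac{1}{\mu}\cdot\frac{\phi_{\min}-\phi(0)}{\phi'(0)},\ \alpha_{\max}\right)\right)\right\rceil.$$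
   Context: The function $\phi$ is the univariate line search objective along the descent direction $p$, with derivative $\phi'(\alpha)=p^\top\nabla f(x+\alpha p)$; in particular $\phi'(0)<0$. The derivative of the auxiliary function is $\psi'(\alpha)=\phi'(\alpha)-\mu\,\phi'(0)$. The value $\alpha_{\max}$ is the maximal allowed step length, with $\alpha_{\max}=\infty$ meaning no bound is imposed. In the stopping conditions, $\alpha_l$ and $\alpha_u$ denote the endpoints of the current interval.
   Formalization: The bound is replaced by the maximum of 0 and the stated ceiling, because the ceiling can be negative (e.g. alpha_max = 1/2, c = 2, phi_min very low: 0 updates but the expression is -2), in which case the claim as stated is false. *)

(* Defs.v *)
From mathcomp Require Export all_boot all_order all_algebra.
From mathcomp Require Export all_classical all_reals all_analysis.
Export Order.TTheory GRing.Theory Num.Theory.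
Export numFieldNormedType.Exports.

Set Implicit Arguments.
Unset Strict Implicit.
Unset Printing Implicit Defensive.

Local Open Scope ring_scope.
Local Open Scope classical_set_scope.

Section Gradient.
Context {R : realType} {n : nat}.
Implicit Types (f : 'cV[R]_n -> R) (x u v : 'cV[R]_n).

Definition dotv u v : R := (u^T *m v) ord0 ord0.

Definition grad f x : 'cV[R]_n := \col_i ('D_(delta_mx i ord0) f x).

Definition continuously_differentiable f : Prop :=
  (forall x, differentiable f x) /\ continuous (grad f).

Definition line_fun f x (p : 'cV[R]_n) (a : R) : R := f (x + a *: p).

End Gradient.

Section LineSearch.
Context {R : realType}.
Implicit Types (phi psi : R -> R) (amax : \bar R) (I : R * R).

Definition aux_fun (mu : R) phi (a : R) : R :=
  phi a - (phi 0 + mu * derive1 phi 0 * a).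

(* min(t, amax) as a real number; [fine] loses nothing, because the minimum of
   a real and an extended real amax > 0 is never infinite. *)
Definition capped (t : R) amax : R := fine (Order.min t%:E amax).

Definition logb (b y : R) : R := ln y / ln b.

(* An interval [alpha_l, alpha_u] is the pair (alpha_l, alpha_u). *)
Definition init_interval amax : R * R := (0, capped 1 amax).

Definition update_interval (c : R) amax I : R * R :=
  (I.2, capped (c * I.2) amax).

Definition stopping psi amax I : Prop :=
  [\/ I.2%:E = amax, psi I.2 >= psi I.1 | derive1 psi I.2 >= 0].

(* The stopping test is evaluated before every update, so N = 0 when the
   initial interval already satisfies it. *)
Definition number_of_updates psi (c : R) amax (N : nat) : Prop :=
  let interval k := iter k (update_interval c amax) (init_interval amax) in
  stopping psi amax (interval N) /\
  forall k, (k < N)%N -> ~ stopping psi amax (interval k).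

End LineSearch.

(* Main.v *)
(** As long as the test fails, the cap [amax] is inactive, so [a0 = 1] and after
    [k] updates [alpha_u = c ^ k < amax]; moreover [psi (alpha_u)] has decreased
    strictly from [psi 0 = 0]. Since [psi < 0] and [phi > phi_min] force
    [alpha_u < (phi_min - phi 0) / (mu * phi' 0)], it follows that
    [k < log_c (min ((phi_min - phi 0) / (mu * phi' 0)) amax)]. *)

Require Import Defs.
From mathcomp Require Import lra.

Local Open Scope ring_scope.
Local Open Scope classical_set_scope.

(** The differential of [f] at [x] is linear, so its value at [p] expands over the canonical basis
    into partial derivatives. This turns the descent hypothesis into [phi' 0 < 0]. *)
Lemma derive1_line_fun (R : realType) (n : nat) (f : 'cV[R]_n -> R)
  (x p : 'cV[R]_n) :
  differentiable f x -> derive1 (line_fun f x p) 0 = dotv p (grad f x).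
Proof.
move=> dfx.
have -> : derive1 (line_fun f x p) 0 = 'D_p f x.
  rewrite /derive1 /derive /line_fun scale0r addr0.
  suff -> : (fun h : R => h^-1 *: (f (x + (h + 0) *: p) - f x)) =
            (fun h : R => h^-1 *: ((f \o shift x) (h *: p) - f x)) by [].
  by apply/funext => h /=; rewrite addr0 (addrC x).
rewrite deriveE // {1}[p]matrix_sum_delta linear_sum /dotv mxE.
apply: eq_bigr => i _.
by rewrite big_ord1 linearZ /= !mxE -deriveE.
Qed.

Lemma cappedE (R : realType) (t : R) (amax : \bar R) :
  (0 < amax)%E -> (capped t amax)%:E = Order.min t%:E amax.
Proof.
rewrite /capped minEle; case: ifP => // /negbT; rewrite -ltNge.
by case: amax => //= r; rewrite ltNyr.
Qed.

Lemma capped_inactive (R : realType) (t : R) (amax : \bar R) :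
  (0 < amax)%E -> (capped t amax)%:E <> amax ->
  capped t amax = t /\ (t%:E < amax)%E.
Proof.
move=> amax_gt0; rewrite cappedE // /capped minEle.
case: ifP => [le_t /eqP ne_t|_ /(_ erefl)[]].
by split; rewrite // lt_neqAle ne_t.
Qed.

(** An update makes the old right endpoint the new left one, so the strict decreases of [psi] given
    by the failed tests chain down from [psi 0]. *)
Lemma unstopped_interval (R : realType) (psi : R -> R) (c : R) (amax : \bar R)
    (k : nat) :
  (0 < amax)%E ->
  (forall j, (j <= k)%N -> ~ stopping psi amax
     (iter j (update_interval c amax) (init_interval amax))) ->
  [/\ (iter k (update_interval c amax) (init_interval amax)).2 = c ^+ k,
      ((c ^+ k)%:E < amax)%E & psi (c ^+ k) < psi 0].
Proof.
move=> amax_gt0.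
have unstop I : ~ stopping psi amax I -> I.2%:E <> amax /\ psi I.2 < psi I.1.
  move=> nstop; split; first by move=> e; apply: nstop; exact: Or31.
  by rewrite ltNge; apply/negP => le_psi; apply: nstop; exact: Or32.
elim: k => [|k IHk] nstop /=.
  have [/(capped_inactive _ _ _ amax_gt0) /= [e lt1]] := unstop _ (nstop 0 isT).
  by rewrite /= e expr0.
have [j lejk|IHe _ IHpsi] := IHk; first by apply: nstop; rewrite leqW.
have [] := unstop _ (nstop _ (leqnn _)).
rewrite /= IHe -exprS => /(capped_inactive _ _ _ amax_gt0)[-> lt_amax] lt_psi.
by split=> //; exact: lt_trans lt_psi IHpsi.
Qed.

(** Here [phi_min - phi 0 < phi a - phi 0 < mu * phi' 0 * a]; dividing by the negative [mu * phi' 0]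
    reverses the inequality. *)
Lemma aux_fun_lt0_bound (R : realType) (mu phi_min a : R) (phi : R -> R) :
  0 < mu -> derive1 phi 0 < 0 -> phi_min < phi a -> aux_fun mu phi a < 0 ->
  a < 1 / mu * ((phi_min - phi 0) / derive1 phi 0).
Proof.
rewrite /aux_fun; set d := derive1 phi 0 => mu_gt0 d_lt0 lt_phi psi_lt0.
rewrite mul1r mulrA ltr_ndivlMr // ltr_pdivrMl //; lra.
Qed.

Lemma lt_logb (R : realType) (c y : R) (k : nat) :
  1 < c -> c ^+ k < y -> k%:R < logb c y.
Proof.
move=> c_gt1 lt_y; have c_gt0 : 0 < c by lra.
have ck_gt0 := exprn_gt0 k c_gt0.
rewrite /logb ltr_pdivlMr ?ln_gt0 // mulr_natl -lnXn //.
by rewrite ltr_ln ?posrE // (lt_trans ck_gt0).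
Qed.

Theorem theorem2 (R : realType) (n : nat) (f : 'cV[R]_n -> R)
  (x p : 'cV[R]_n) (mu c : R) (amax : \bar R) (phi_min : R) :
  let phi : R -> R := line_fun f x p in
  let psi : R -> R := aux_fun mu phi in
  let a0 : R := capped 1 amax in
  continuously_differentiable f ->
  dotv p (grad f x) < 0 ->
  0 < mu < 1 ->
  1 < c ->
  (0 < amax)%E ->
  (forall a : R, 0 <= a -> phi_min < phi a) ->
  exists N : nat,
    number_of_updates psi c amax N /\
    N%:Z <= Num.max 0
      (Num.ceil (1 / a0 *
         logb c (capped (1 / mu * ((phi_min - phi 0) / derive1 phi 0)) amax))).
Proof.
move=> phi psi a0 [df _] descent /andP[mu_gt0 _] c_gt1 amax_gt0 lt_phi.
set B := Num.ceil _.
have d_lt0 : derive1 phi 0 < 0 by rewrite derive1_line_fun.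
pose stopped k := stopping psi amax
  (iter k (update_interval c amax) (init_interval amax)).
have bound k : (forall j, (j <= k)%N -> ~ stopped j) -> k%:Z < B.
  move=> nstop.
  have [_ lt_amax lt_psi] := unstopped_interval _ _ _ _ _ amax_gt0 nstop.
  (* The failed test on the initial interval, whose right endpoint is [a0], already gives
     [a0 = c ^+ 0]. *)
  have a01 : a0 = 1.
    have [|e1 _ _] := unstopped_interval _ psi c _ 0 amax_gt0.
      by move=> j lej0; apply: nstop; exact: leq_trans lej0 _.
    by rewrite expr0 in e1.
  rewrite ceil_gt_int a01 divr1 mul1r; apply: lt_logb => //.
  rewrite -lte_fin cappedE // lt_min lt_amax andbT lte_fin.
  apply: aux_fun_lt0_bound => //.
    by apply/lt_phi/exprn_ge0; lra.
  by apply: lt_le_trans lt_psi _; rewrite /psi /aux_fun mulr0 addr0 subrr.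
have exN : exists k, `[< stopped k >].
  (* If the test never succeeded, [bound] at [k = |B|] would give [|B| < B]. *)
  apply: contrapT => never.
  have : `|B|%N%:Z < B.
    by apply: bound => j _ stopj; apply: never; exists j; exact/asboolP.
  by rewrite ltNge lez_abs.
case: (ex_minnP exN) => N /asboolP stopN minN.
have nstop k : (k < N)%N -> ~ stopped k.
  by move=> ltkN /asboolP /minN; rewrite leqNgt ltkN.
exists N; split; first by [].
(* For [N = 0] the [0] in the maximum suffices, whatever the sign of [B]. For [N = k + 1], [bound k]
   gives [k < B], which over the integers is [N <= B]. *)
by rewrite le_max; case: N nstop {stopN minN}.
Qed.
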